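(* Let $\Bbbk$ be an algebraically closed field of characteristic zero, let $\mathcal{A}$ be the Kac–Paljutkin Hopf algebra over $\Bbbk$, let $q\in\Bbbk$ be a primitive fourth root of unity, and let $\lambda:\mathcal{A}\to\Bbbk$ be a partial action. (1) If $\lambda=\lambda_\zeta$ with $\zeta\in\{q,-q\}$, then $\mathcal{A}_{\lambda_\zeta}$ is not a Hopf subalgebra of $\mathcal{A}$. (2) If $\lambda=\lambda_N^0$ for a subgroup $N$ of $G(\mathcal{A})$, then $\mathcal{A}_{\lambda_N^0}$ is a Hopf subalgebra of $\mathcal{A}$, and in this case $\mathcal{A}_{\lambda_N^0}\cong\Bbbk N$.
   Context: A partial action of a Hopf algebra $H$ on its base field $\Bbbk$ is a linear map $\lambda:H\to\Bbbk$ with $\lambda(1_H)=1$ and $\lambda(u)\lambda(v)=\lambda(u_1)\lambda(u_2v)$ for all $u,v\in H$ (Sweedler notation). For such $\lambda$, $H_\lambda:=\{\lambda(u_1)u_2\mid u\in H\}\subseteq H$, which is a right coideal subalgebra of $H$ (identified with the partial smash product $\underline{\Bbbk\#H}$). The Kac–Paljutkin algebra $\mathcal{A}$ is the $8$-dimensional Hopf algebra generated as an algebra by $g,h,x$ with relations $g^2=h^2=1$, $x^2=\tfrac12(1+g+h-gh)$, $hg=gh$, $xh=gx$, $xg=hx$; it has linear basis $\mathcal{B}_{\mathcal{A}}=\{1,g,h,gh,x,gx,hx,ghx\}$. Its coproduct is determined by $g,h$ being grouplike and $\Delta(x)=\tfrac12(x\otimes x+x\otimes gx+hx\otimes x-hx\otimes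 gx)$; $\varepsilon(k)=1$ for all $k\in\mathcal{B}_{\mathcal{A}}$; $S(g)=g$, $S(h)=h$, $S(x)=x$. Its group of grouplike elements is $G(\mathcal{A})=\{1,g,h,gh\}\cong C_2\times C_2$. For a subgroup $N$ of $G(\mathcal{A})$, the linear map $\lambda_N^0:\mathcal{A}\to\Bbbk$ is given by $\lambda_N^0(t)=1$ if $t\in N$ and $\lambda_N^0(t)=0$ if $t\in\mathcal{B}_{\mathcal{A}}\setminus N$. For $\zeta\in\{q,-q\}$, the linear map $\lambda_\zeta:\mathcal{A}\to\Bbbk$ is given by $\lambda_\zeta(1)=\lambda_\zeta(gh)=1$, $\lambda_\zeta(g)=\lambda_\zeta(h)=0$, $\lambda_\zeta(x)=\lambda_\zeta(ghx)=\tfrac{1+\zeta}{2}$, $\lambda_\zeta(gx)=\lambda_\zeta(hx)=\tfrac{1-\zeta}{2}$. All of these maps are partial actions of $\mathcal{A}$ on $\Bbbk$. *)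

(* Defs.v *)
From HB Require Import structures.
From mathcomp Require Import all_boot all_order all_algebra.
From mathcomp Require Import all_fingroup all_solvable all_field.
From mathcomp Require Import ring.

Set Implicit Arguments.
Unset Strict Implicit.
Unset Printing Implicit Defensive.

Import GRing.Theory.
Local Open Scope ring_scope.

Section Tensor.
Variable K : fieldType.

(* U ⊗ V for finite-dimensional U, V: a tensor is the matrix of its coordinates
   in the products of the vectors of the canonical bases of U and V. *)
Definition tens (U V : vectType K) := 'M[K]_(\dim {:U}, \dim {:V}).

Definition tensor (U V : vectType K) (u : U) (v : V) : tens U V :=
  \matrix_(i, j) (coord (vbasis {:U}) i u * coord (vbasis {:V}) j v).

(* The value at t of the linear map U ⊗ V -> W induced by a bilinear map f
   (see sweedler_tensor); for t = Delta(u), this is f(u_1, u_2) in Sweedler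
   notation. *)
Definition sweedler (U V : vectType K) (W : lmodType K)
    (f : U -> V -> W) (t : tens U V) : W :=
  \sum_i \sum_j t i j *: f (vbasis {:U})`_i (vbasis {:V})`_j.

End Tensor.
Notation "u ⊗ v" := (tensor u v) (at level 40, left associativity) : ring_scope.

Section TensorTheory.
Variable K : fieldType.
Implicit Types U V : vectType K.

Lemma vb_expand U (u : U) :
  u = \sum_i coord (vbasis {:U}) i u *: (vbasis {:U})`_i.
Proof. exact: coord_vbasis (memvf u). Qed.

Section Lift.
Variables (U V : vectType K) (W : lmodType K).
Implicit Type f : U -> V -> W.

Lemma sweedler_linear f : linear (sweedler f).
Proof.
move=> a s t; rewrite /sweedler scaler_sumr -big_split; apply: eq_bigr => i _.
rewrite scaler_sumr -big_split; apply: eq_bigr => j _ /=.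
by rewrite !mxE scalerDl scalerA.
Qed.
HB.instance Definition _ f :=
  GRing.isLinear.Build K (tens U V) W *:%R (sweedler f) (sweedler_linear f).

Lemma sweedler_tensor f (u : U) (v : V) :
    (forall b, linear (f^~ b)) -> (forall a, linear (f a)) ->
  sweedler f (u ⊗ v) = f u v.
Proof.
move=> fl fr.
pose f1 b : {linear U -> W} :=
  HB.pack (f^~ b) (GRing.isLinear.Build _ _ _ _ _ (fl b)).
pose f2 a : {linear V -> W} :=
  HB.pack (f a) (GRing.isLinear.Build _ _ _ _ _ (fr a)).
rewrite -[RHS]/(f1 v u) {2}(vb_expand u) linear_sum; apply: eq_bigr => i _.
rewrite [RHS]linearZ_LR -[f1 _ _]/(f2 (vbasis {:U})`_i v) {2}(vb_expand v).
rewrite linear_sum scaler_sumr; apply: eq_bigr => j _.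
by rewrite [f2 _ _]linearZ_LR mxE scalerA.
Qed.

End Lift.

Lemma sweedler_fun (U V : vectType K) (W : lmodType K) (f g h : U -> V -> W)
    (k : K) (t : tens U V) :
    (forall a b, f a b = k *: g a b + h a b) ->
  sweedler f t = k *: sweedler g t + sweedler h t.
Proof.
move=> E; rewrite /sweedler scaler_sumr -big_split; apply: eq_bigr => i _ /=.
rewrite scaler_sumr -big_split; apply: eq_bigr => j _ /=.
by rewrite E scalerDr !scalerA mulrC.
Qed.

Section Pure.
Variables U V : vectType K.

Lemma tensor_linearl (v : V) : linear (fun u : U => u ⊗ v).
Proof. by move=> a u u'; apply/matrixP=> i j; rewrite !mxE linearP mulrDl mulrA. Qed.
Lemma tensor_linearr (u : U) : linear (fun v : V => u ⊗ v).
Proof. by move=> a v v'; apply/matrixP=> i j; rewrite !mxE linearP mulrDr mulrCA. Qed.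

Lemma tensorPl (k : K) (u u' : U) (v : V) :
  (k *: u + u') ⊗ v = k *: (u ⊗ v) + u' ⊗ v.
Proof. exact: tensor_linearl. Qed.
Lemma tensorPr (k : K) (u : U) (v v' : V) :
  u ⊗ (k *: v + v') = k *: (u ⊗ v) + u ⊗ v'.
Proof. exact: tensor_linearr. Qed.

Lemma tens_expand (t : tens U V) : t = sweedler (@tensor K U V) t.
Proof.
rewrite /sweedler; apply/matrixP => i j.
have E (i' : 'I_(\dim {:U})) (j' : 'I_(\dim {:V})) :
    ((vbasis {:U})`_i' ⊗ (vbasis {:V})`_j') i j
             = (i == i')%:R * (j == j')%:R.
  by rewrite mxE !coord_free ?(basis_free (vbasisP _)) // [i' == _]eq_sym [j' == _]eq_sym.
rewrite summxE (bigD1 i) //= summxE (bigD1 j) //= [X in _ + X + _]big1 => [|j' nj].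
  rewrite [X in _ + X]big1 => [|i' ni]; first by rewrite mxE E !eqxx !mulr1 !addr0.
  rewrite summxE big1 // => j' _.
  by rewrite mxE E [i == _]eq_sym (negPf ni) mul0r mulr0.
by rewrite mxE E [j == _]eq_sym (negPf nj) !mulr0.
Qed.

End Pure.
End TensorTheory.

Section Hopf.
Variable K : fieldType.

Definition tens_mul (A : falgType K) (s t : tens A A) : tens A A :=
  sweedler (fun a b => sweedler (fun c d => (a * c) ⊗ (b * d)) t) s.

(* The structure maps only; the axioms are hopf_axioms below. *)
Record hopf_data (A : falgType K) := HopfData {
  comul : 'Hom(A, tens A A);
  counit : 'Hom(A, K^o);
  antipode : 'End(A) }.

Definition hopf_axioms (A : falgType K) (H : hopf_data A) : Prop :=
  let D := comul H in let eps := counit H in let S := antipode H in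
  [/\ [/\ D 1 = 1 ⊗ 1, forall u v, D (u * v) = tens_mul (D u) (D v),
          eps 1 = 1 & forall u v, eps (u * v) = eps u * eps v],
      (* coassociativity, with (A ⊗ A) ⊗ A reassociated as A ⊗ (A ⊗ A) *)
      forall u,
        sweedler (fun a b => sweedler (fun c d => c ⊗ (d ⊗ b)) (D a)) (D u) =
        sweedler (fun a b => a ⊗ D b) (D u),
      forall u, sweedler (fun a b => eps a *: b) (D u) = u
             /\ sweedler (fun a b => eps b *: a) (D u) = u &
      forall u, sweedler (fun a b => S a * b) (D u) = eps u *: 1
             /\ sweedler (fun a b => a * S b) (D u) = eps u *: 1].

End Hopf.

Lemma tens_mulE (K : fieldType) (A : falgType K) (a b c d : A) :
  tens_mul (a ⊗ b) (c ⊗ d) = (a * c) ⊗ (b * d).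
Proof.
rewrite /tens_mul !sweedler_tensor //.
- by move=> v k u u' /=; rewrite mulrDr -scalerAr tensorPl.
- by move=> v k u u' /=; rewrite mulrDr -scalerAr tensorPr.
- move=> v k u u' /=; apply: sweedler_fun => x y.
  by rewrite mulrDl -scalerAl tensorPl.
- move=> v k u u' /=; apply: sweedler_fun => x y.
  by rewrite mulrDl -scalerAl tensorPr.
Qed.

Lemma tens_mulPl (K : fieldType) (A : falgType K) (t : tens A A) k s s' :
  tens_mul (k *: s + s') t = k *: tens_mul s t + tens_mul s' t.
Proof. exact: linearP. Qed.
Fact tens_mul_linear (K : fieldType) (A : falgType K) (t : tens A A) :
  linear (tens_mul t).
Proof. by move=> k s s'; apply: sweedler_fun => a b; rewrite linearP. Qed.
HB.instance Definition _ (K : fieldType) (A : falgType K) (t : tens A A) :=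
  GRing.isLinear.Build K (tens A A) (tens A A) *:%R (tens_mul t)
    (@tens_mul_linear K A t).

Section GroupAlgebra.
Variables (K : fieldType) (gT : finGroupType).

(* The group algebra: functions with the convolution product. *)
Definition grpalg : Type := {ffun gT -> K^o}.
HB.instance Definition _ := Vector.on grpalg.
Implicit Types a b c : grpalg.

Definition grpel (t : gT) : grpalg := [ffun s => (s == t)%:R].
Definition grpalg_mul a b : grpalg := [ffun t => \sum_s a s * b (s^-1 * t)%g].

Fact grpalg_mulA : associative grpalg_mul.
Proof.
move=> a b c; apply/ffunP => t; rewrite !ffunE.
under eq_bigr do rewrite ffunE mulr_sumr.
under [RHS]eq_bigr do rewrite ffunE mulr_suml.
rewrite [RHS]exchange_big; apply: eq_bigr => s _.
rewrite [RHS](reindex_inj (mulgI s)); apply: eq_bigr => r _.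
by rewrite mulKg invMg mulgA mulrA.
Qed.
Fact grpalg_mul1 : left_id (grpel 1) grpalg_mul.
Proof.
move=> a; apply/ffunP => t; rewrite ffunE (bigD1 1%g) //= big1 => [|s ns].
  by rewrite ffunE eqxx mul1r invg1 mul1g addr0.
by rewrite ffunE (negPf ns) mul0r.
Qed.
Fact grpalg_1mul : right_id (grpel 1) grpalg_mul.
Proof.
move=> a; apply/ffunP => t; rewrite ffunE (bigD1 t) //= big1 => [|s ns].
  by rewrite ffunE mulVg eqxx mulr1 addr0.
by rewrite ffunE -eq_mulVg1 (negPf ns) mulr0.
Qed.
Fact grpalg_mulDl : left_distributive grpalg_mul +%R.
Proof.
move=> a b c; apply/ffunP => t; rewrite !ffunE -big_split.
by apply: eq_bigr => s _; rewrite ffunE mulrDl.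
Qed.
Fact grpalg_mulDr : right_distributive grpalg_mul +%R.
Proof.
move=> a b c; apply/ffunP => t; rewrite !ffunE -big_split.
by apply: eq_bigr => s _; rewrite ffunE mulrDr.
Qed.
Fact grpalg_1neq0 : grpel 1 != 0.
Proof. by apply/eqP => /ffunP/(_ 1%g)/eqP; rewrite !ffunE eqxx oner_eq0. Qed.
HB.instance Definition _ := GRing.Zmodule_isNzRing.Build grpalg
  grpalg_mulA grpalg_mul1 grpalg_1mul grpalg_mulDl grpalg_mulDr grpalg_1neq0.

Fact grpalg_scaleAl (k : K) a b :
  k *: grpalg_mul a b = grpalg_mul (k *: a) b.
Proof.
apply/ffunP => t; rewrite !ffunE scaler_sumr.
by apply: eq_bigr => s _; rewrite ffunE scalerAl.
Qed.
Fact grpalg_scaleAr (k : K) a b :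
  k *: grpalg_mul a b = grpalg_mul a (k *: b).
Proof.
apply/ffunP => t; rewrite !ffunE scaler_sumr.
by apply: eq_bigr => s _; rewrite ffunE scalerAr.
Qed.
HB.instance Definition _ := GRing.Lmodule_isLalgebra.Build K grpalg grpalg_scaleAl.
HB.instance Definition _ := GRing.Lalgebra_isAlgebra.Build K grpalg grpalg_scaleAr.
HB.instance Definition _ := Algebra_isFalgebra.Build K grpalg.

Lemma grpel1 : grpel 1 = 1. Proof. by []. Qed.

Lemma grpelM s t : grpel s * grpel t = grpel (s * t).
Proof.
apply/ffunP => r; rewrite ffunE (bigD1 s) //= big1 => [|u nu].
  by rewrite !ffunE eqxx mul1r addr0 (can2_eq (mulKVg s) (mulKg s)).
by rewrite ffunE (negPf nu) mul0r.
Qed.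

Definition grpalg_ext (W : lmodType K) (F : gT -> W) a : W :=
  \sum_t a t *: F t.

Fact grpalg_ext_linear (W : lmodType K) (F : gT -> W) : linear (grpalg_ext F).
Proof.
move=> k a b; rewrite /grpalg_ext scaler_sumr -big_split.
by apply: eq_bigr => t _; rewrite !ffunE scalerDl scalerA.
Qed.
HB.instance Definition _ (W : lmodType K) (F : gT -> W) :=
  GRing.isLinear.Build K grpalg W *:%R (grpalg_ext F) (@grpalg_ext_linear W F).

Lemma grpalg_ext_el (W : lmodType K) (F : gT -> W) t : grpalg_ext F (grpel t) = F t.
Proof.
rewrite /grpalg_ext (bigD1 t) //= big1 => [|s ns].
  by rewrite ffunE eqxx scale1r addr0.
by rewrite ffunE (negPf ns) scale0r.
Qed.

Lemma grpalg_expand a : a = grpalg_ext grpel a.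
Proof.
apply/ffunP => t; rewrite sum_ffunE (bigD1 t) //= big1 => [|s ns].
  by rewrite !ffunE eqxx /= [_ *: _]mulr1 addr0.
by rewrite !ffunE eq_sym (negPf ns) [_ *: _]mulr0.
Qed.

Lemma grpalg_linP (W : lmodType K) (f1 f2 : grpalg -> W) :
    linear f1 -> linear f2 ->
  (forall t, f1 (grpel t) = f2 (grpel t)) -> f1 =1 f2.
Proof.
move=> l1 l2 E a.
pose g1 : {linear grpalg -> W} := HB.pack f1 (GRing.isLinear.Build _ _ _ _ _ l1).
pose g2 : {linear grpalg -> W} := HB.pack f2 (GRing.isLinear.Build _ _ _ _ _ l2).
rewrite -[LHS]/(g1 a) -[RHS]/(g2 a) (grpalg_expand a) !linear_sum.
by apply: eq_bigr => t _; rewrite !linearZ_LR; congr (_ *: _); apply: E.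
Qed.

Lemma grpalg_bilinP (W : lmodType K) (f1 f2 : grpalg -> grpalg -> W) :
    (forall b, linear (f1^~ b)) -> (forall b, linear (f2^~ b)) ->
    (forall a, linear (f1 a)) -> (forall a, linear (f2 a)) ->
    (forall s t, f1 (grpel s) (grpel t) = f2 (grpel s) (grpel t)) ->
  f1 =2 f2.
Proof.
move=> l1 l2 r1 r2 E a b; move: a; apply: grpalg_linP => // s.
by move: b; apply: grpalg_linP.
Qed.

Definition grpalg_hopf : hopf_data grpalg := HopfData
  (linfun (grpalg_ext (fun t => grpel t ⊗ grpel t)))
  (linfun (grpalg_ext (fun t => 1 : K^o)))
  (linfun (grpalg_ext (fun t => grpel t^-1))).

End GroupAlgebra.

Section PartialAction.
Variables (K : fieldType) (A : falgType K) (H : hopf_data A).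

Definition partial_action (l : 'Hom(A, K^o)) : Prop :=
  l 1 = 1 /\
  forall u v, l u * l v = sweedler (fun a b => l a * l (b * v)) (comul H u).

(* A_l = { l(u_1) u_2 | u in A }; see memv_smash. *)
Definition smash (l : 'Hom(A, K^o)) : {vspace A} :=
  limg (linfun (fun u => sweedler (fun a b => l a *: b) (comul H u))).

Definition tensv (U V : {vspace A}) : {vspace tens A A} :=
  <<[seq u ⊗ v | u <- vbasis U, v <- vbasis V]>>%VS.

Definition grouplike (u : A) : Prop := u != 0 /\ comul H u = u ⊗ u.

Definition hopf_subalgebra (B : {vspace A}) : Prop :=
  [/\ 1 \in B, (B * B <= B)%VS, (comul H @: B <= tensv B B)%VS
    & (antipode H @: B <= B)%VS].

End PartialAction.

Section Morphism.
Variables (K : fieldType) (A B : falgType K) (HA : hopf_data A) (HB : hopf_data B).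

Definition hopf_morphism (f : 'Hom(A, B)) : Prop :=
  [/\ f 1 = 1, forall u v, f (u * v) = f u * f v,
      forall u, comul HB (f u) = sweedler (fun a b => f a ⊗ f b) (comul HA u),
      forall u, counit HB (f u) = counit HA u
    & forall u, f (antipode HA u) = antipode HB (f u)].

(* A is isomorphic as a Hopf algebra to the Hopf subalgebra C of B, whose
   structure maps are the restrictions of those of B. *)
Definition hopf_iso_onto (C : {vspace B}) : Prop :=
  exists f : 'Hom(A, B), [/\ hopf_morphism f, lker f == 0%VS & limg f = C].

End Morphism.

(* (i, j) : V4 stands for g^i h^j; the group law on bool is addb. V4swap is
   conjugation by x, since x g = h x and x h = g x. *)
Notation V4 := (bool * bool)%type.
Definition V4g : V4 := (true, false).
Definition V4h : V4 := (false, true).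
Definition V4swap (t : V4) : V4 := (t.2, t.1).

Lemma V4mulC (s t : V4) : (s * t)%g = (t * s)%g.
Proof. by case: s => [[] []]; case: t => [[] []]. Qed.
Lemma V4inv (t : V4) : (t^-1)%g = t. Proof. by case: t => [[] []]. Qed.
Lemma V4swapK : involutive V4swap. Proof. by case. Qed.
Lemma V4swapM (s t : V4) : V4swap (s * t)%g = (V4swap s * V4swap t)%g.
Proof. by []. Qed.

Section KacPaljutkin.
Variable K : fieldType.
Notation kV4 := (grpalg K V4).
Notation e := (@grpel K V4).

Definition kp_J : kV4 := 2^-1 *: (1 + e V4g + e V4h - e V4g * e V4h).
Definition kp_swap : kV4 -> kV4 := grpalg_ext (fun t => e (V4swap t)).
HB.instance Definition _ := GRing.Linear.on kp_swap.

Lemma kp_swap_el t : kp_swap (e t) = e (V4swap t).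
Proof. exact: grpalg_ext_el. Qed.

Lemma kV4_mulC (a b : kV4) : a * b = b * a.
Proof.
move: a b; apply: grpalg_bilinP => [b k u v|b k u v|a k u v|a k u v|s t] /=.
- by rewrite mulrDl scalerAl.
- by rewrite mulrDr scalerAr.
- by rewrite mulrDr scalerAr.
- by rewrite mulrDl scalerAl.
by rewrite !grpelM V4mulC.
Qed.

Lemma kp_swapM a b : kp_swap (a * b) = kp_swap a * kp_swap b.
Proof.
move: a b; apply: grpalg_bilinP => [b k u v|b k u v|a k u v|a k u v|s t] /=.
- by rewrite mulrDl -scalerAl linearP.
- by rewrite linearP mulrDl scalerAl.
- by rewrite mulrDr -scalerAr linearP.
- by rewrite linearP mulrDr scalerAr.
by rewrite grpelM !kp_swap_el grpelM V4swapM.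
Qed.

Lemma kp_swapK : involutive kp_swap.
Proof.
apply: grpalg_linP => [k u v|//|t]; first by rewrite !linearP.
by rewrite !kp_swap_el V4swapK.
Qed.

Lemma kp_swap1 : kp_swap 1 = 1.
Proof. exact: kp_swap_el. Qed.

Lemma kp_swap_J : kp_swap kp_J = kp_J.
Proof.
rewrite linearZ_LR linearB 2!linearD /= kp_swapM kp_swap1 !kp_swap_el.
by rewrite (addrAC 1) [e (V4swap V4g) * _]kV4_mulC.
Qed.

(* The pair (a, b) stands for a + b x, with a and b in the group algebra of
   {1, g, h, gh}. Hence (a + b x)(c + d x) = ac + b s(d) x^2 + (ad + b s(c)) x,
   where s is kp_swap and x^2 = kp_J. The defining relations are kp_elM, kp_x_el
   and kp_xx, and the basis is {kp_el t, kp_el t * kp_x | t : V4}. *)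
Definition kac_paljutkin : Type := (kV4 * kV4)%type.
Notation kp := kac_paljutkin.
HB.instance Definition _ := Vector.on kp.

Definition kp_mul (u v : kp) : kp :=
  (u.1 * v.1 + u.2 * kp_swap v.2 * kp_J, u.1 * v.2 + u.2 * kp_swap v.1).

Fact kp_mulA : associative kp_mul.
Proof.
move=> [a b] [c d] [m n]; congr pair => /=;
  rewrite !linearD /= !kp_swapM kp_swapK ?kp_swap_J !mulrDl !mulrDr !mulrA.
  rewrite -[in RHS]addrA [b * _ * _ * m + _]addrC.
  rewrite -[_ * kp_J * m]mulrA [kp_J * m]kV4_mulC !mulrA mulrDl.
  by rewrite !addrA.
rewrite -[_ * kp_J * n]mulrA [kp_J * n]kV4_mulC !mulrA.
by rewrite -!addrA; congr (_ + _); rewrite [RHS]addrC addrA.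
Qed.
Fact kp_mul1 : left_id (1, 0) kp_mul.
Proof. by case=> a b; rewrite /kp_mul /= !mul1r !mul0r !addr0. Qed.
Fact kp_1mul : right_id (1, 0) kp_mul.
Proof.
case=> a b; rewrite /kp_mul /= kp_swap1 linear0 !mulr0 !mulr1 mul0r.
by rewrite addr0 add0r.
Qed.
Fact kp_mulDl : left_distributive kp_mul +%R.
Proof. by move=> [a b] [c d] [m n]; congr pair; rewrite /= !mulrDl addrACA. Qed.
Fact kp_mulDr : right_distributive kp_mul +%R.
Proof.
move=> [a b] [c d] [m n]; congr pair;
by rewrite /= linearD !mulrDr ?mulrDl addrACA.
Qed.
Fact kp_1neq0 : (1, 0) != 0 :> kp.
Proof. by apply/eqP => /(congr1 fst)/eqP; rewrite /= oner_eq0. Qed.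
HB.instance Definition _ := GRing.Zmodule_isNzRing.Build kp
  kp_mulA kp_mul1 kp_1mul kp_mulDl kp_mulDr kp_1neq0.

Fact kp_scaleAl (k : K) (u v : kp) : k *: kp_mul u v = kp_mul (k *: u) v.
Proof. by congr (_, _); rewrite /= scalerDr !scalerAl. Qed.
Fact kp_scaleAr (k : K) (u v : kp) : k *: kp_mul u v = kp_mul u (k *: v).
Proof.
congr (_, _); rewrite /= linearZ_LR scalerDr.
  by rewrite scalerAr scalerAl scalerAr.
by rewrite -!scalerAr.
Qed.
HB.instance Definition _ := GRing.Lmodule_isLalgebra.Build K kp kp_scaleAl.
HB.instance Definition _ := GRing.Lalgebra_isAlgebra.Build K kp kp_scaleAr.
HB.instance Definition _ := Algebra_isFalgebra.Build K kp.

Definition kp_el (t : V4) : kp := (e t, 0).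
Definition kp_x : kp := (0, 1).

Lemma kp_mulE (u v : kp) : u * v = kp_mul u v. Proof. by []. Qed.
Lemma kp_el1 : kp_el 1%g = 1. Proof. by []. Qed.
Lemma kp_elM s t : kp_el s * kp_el t = kp_el (s * t)%g.
Proof. by rewrite kp_mulE /kp_mul /= linear0 !mul0r mulr0 !addr0 grpelM. Qed.
Lemma kp_el_x t : kp_el t * kp_x = (0, e t).
Proof. by rewrite kp_mulE /kp_mul /= linear0 !mul0r mulr0 !addr0 mulr1. Qed.
Lemma kp_x_el t : kp_x * kp_el t = kp_el (V4swap t) * kp_x.
Proof.
rewrite kp_el_x kp_mulE /kp_mul /= linear0 mulr0 !mul0r addr0 add0r mul1r.
by rewrite kp_swap_el.
Qed.
Lemma kp_xx :
  kp_x * kp_x = 2^-1 *: (1 + kp_el V4g + kp_el V4h - kp_el V4g * kp_el V4h).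
Proof.
rewrite kp_elM kp_mulE /kp_mul /= kp_swap1 linear0 !mul0r mulr0 !addr0 add0r !mul1r.
by congr (_, _); rewrite /= ?subr0 ?addr0 ?scaler0 // /kp_J grpelM.
Qed.

(* The linear map with values F0 t at t and F1 t at t x. *)
Definition kp_ext (W : lmodType K) (F0 F1 : V4 -> W) (u : kp) : W :=
  grpalg_ext F0 u.1 + grpalg_ext F1 u.2.
Fact kp_ext_linear (W : lmodType K) (F0 F1 : V4 -> W) : linear (kp_ext F0 F1).
Proof. by move=> k u v; rewrite /kp_ext !linearP addrACA -scalerDr. Qed.
HB.instance Definition _ (W : lmodType K) (F0 F1 : V4 -> W) :=
  GRing.isLinear.Build K kp W *:%R (kp_ext F0 F1) (kp_ext_linear F0 F1).

Lemma kp_ext_el (W : lmodType K) (F0 F1 : V4 -> W) t :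
  kp_ext F0 F1 (kp_el t) = F0 t.
Proof. by rewrite /kp_ext grpalg_ext_el linear0 addr0. Qed.
Lemma kp_ext_elx (W : lmodType K) (F0 F1 : V4 -> W) t :
  kp_ext F0 F1 (kp_el t * kp_x) = F1 t.
Proof. by rewrite kp_el_x /kp_ext grpalg_ext_el linear0 add0r. Qed.

Lemma kp_linP (W : lmodType K) (f1 f2 : kp -> W) :
    linear f1 -> linear f2 ->
    (forall t, f1 (kp_el t) = f2 (kp_el t)) ->
    (forall t, f1 (kp_el t * kp_x) = f2 (kp_el t * kp_x)) ->
  f1 =1 f2.
Proof.
move=> l1 l2 E0 E1 [a b].
have -> : (a, b) = (1 : K) *: ((a, 0) : kp) + (0, b) :> kp.
  by rewrite scale1r; congr (_, _); rewrite /= ?addr0 ?add0r.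
rewrite l1 l2; congr (_ *: _ + _).
  move: a; apply: grpalg_linP => // k u v.
    rewrite -l1; congr f1; congr (_, _) => //=.
    by rewrite scaler0 addr0.
  rewrite -l2; congr f2; congr (_, _) => //=.
  by rewrite scaler0 addr0.
move: b; apply: grpalg_linP => [k u v|k u v|t]; last by rewrite -kp_el_x.
  rewrite -l1; congr f1; congr (_, _) => //=.
  by rewrite scaler0 addr0.
rewrite -l2; congr f2; congr (_, _) => //=.
by rewrite scaler0 addr0.
Qed.

Definition kp_Dx : tens kp kp :=
  2^-1 *: (kp_x ⊗ kp_x + kp_x ⊗ (kp_el V4g * kp_x) +
           (kp_el V4h * kp_x) ⊗ kp_x - (kp_el V4h * kp_x) ⊗ (kp_el V4g * kp_x)).

(* Delta(t x) = (t ⊗ t) Delta(x) and S(t x) = S(x) S(t) = x t. This is a Hopf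
   algebra when 2 != 0 (kp_hopfP), and its grouplike elements are the kp_el t
   (kp_grouplikeP). *)
Definition kp_hopf : hopf_data kp := HopfData
  (linfun (kp_ext (fun t => kp_el t ⊗ kp_el t)
                  (fun t => tens_mul (kp_el t ⊗ kp_el t) kp_Dx)))
  (linfun (kp_ext (fun t => 1 : K^o) (fun t => 1)))
  (linfun (kp_ext kp_el (fun t => kp_x * kp_el t))).

Definition lambda0 (N : {set V4}) : 'Hom(kp, K^o) :=
  linfun (kp_ext (fun t => (t \in N)%:R : K^o) (fun t => 0)).

Definition lambda_zeta (zeta : K) : 'Hom(kp, K^o) :=
  linfun (kp_ext
    (fun t => (t \in [set 1; V4g * V4h]%g)%:R : K^o)
    (fun t => if t \in [set 1; V4g * V4h]%g then (1 + zeta) / 2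
              else (1 - zeta) / 2)).


Lemma kp_comul_el t : comul kp_hopf (kp_el t) = kp_el t ⊗ kp_el t.
Proof. by rewrite lfunE /= kp_ext_el. Qed.
Lemma kp_comul_elx t : comul kp_hopf (kp_el t * kp_x) = 2^-1 *:
  ((kp_el t * kp_x) ⊗ (kp_el t * kp_x)
   + (kp_el t * kp_x) ⊗ (kp_el (t * V4g)%g * kp_x)
   + (kp_el (t * V4h)%g * kp_x) ⊗ (kp_el t * kp_x)
   - (kp_el (t * V4h)%g * kp_x) ⊗ (kp_el (t * V4g)%g * kp_x)).
Proof.
rewrite lfunE /= kp_ext_elx linearZ linearB !linearD /= !tens_mulE.
by rewrite !mulrA !kp_elM !scalerDr.
Qed.
Lemma kp_comul_x : comul kp_hopf kp_x = kp_Dx.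
Proof.
by rewrite -[X in comul _ X]mul1r -kp_el1 kp_comul_elx !mul1g kp_el1 !mul1r.
Qed.
End KacPaljutkin.

Lemma memv_smash (K : fieldType) (A : falgType K) (H : hopf_data A) (l : 'Hom(A, K^o)) v :
  reflect (exists u, v = sweedler (fun a b => l a *: b) (comul H u)) (v \in smash H l).
Proof.
pose f u := sweedler (fun a b => l a *: b) (comul H u).
have fl : linear f by move=> k x y; rewrite /f !linearP.
pose F : {linear A -> A} := HB.pack f (GRing.isLinear.Build _ _ _ _ _ fl).
apply: (iffP memv_imgP) => [[u _ ->]|[u ->]].
  by exists u; rewrite (lfunE F).
by exists u; rewrite ?memvf // (lfunE F).
Qed.

Lemma mem_tensv (K : fieldType) (A : falgType K) (U V : {vspace A}) u v :
  u \in U -> v \in V -> u ⊗ v \in tensv U V.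
Proof.
move=> Uu Vv; rewrite (coord_vbasis Uu) (coord_vbasis Vv).
set c := coord _; set d := coord _.
elim/big_ind: _ => [|x y Hx Hy|i _].
- rewrite [X in X \in _](_ : _ = 0) ?mem0v //.
  by apply/matrixP => i j; rewrite !mxE linear0 mul0r.
- rewrite [X in X \in _](_ : _ = x ⊗ (\sum_i d i v *: (vbasis V)`_i) + y ⊗ (\sum_i d i v *: (vbasis V)`_i)) ?memvD //.
  by apply/matrixP => i j; rewrite !mxE linearD mulrDl.
elim/big_ind: _ => [|x y Hx Hy|j _].
- rewrite [X in X \in _](_ : _ = 0) ?mem0v //.
  by apply/matrixP => k j; rewrite !mxE linear0 mulr0.
- rewrite [X in X \in _](_ : _ = (c i u *: (vbasis U)`_i) ⊗ x + (c i u *: (vbasis U)`_i) ⊗ y) ?memvD //.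
  by apply/matrixP => k j; rewrite !mxE linearD mulrDr.
rewrite [X in X \in _](_ : _ = (c i u * d j v) *: ((vbasis U)`_i ⊗ (vbasis V)`_j)).
  by apply/memvZ/memv_span/allpairs_f; apply: mem_nth; rewrite size_tuple.
apply/matrixP => k m; rewrite !mxE !linearZ /=.
by rewrite mulrACA.
Qed.

Lemma grpalg_hopfP (K : fieldType) (gT : finGroupType) :
  hopf_axioms (grpalg_hopf K gT).
Proof.
pose e := @grpel K gT.
have De t : comul (grpalg_hopf K gT) (e t) = e t ⊗ e t.
  by rewrite lfunE /= grpalg_ext_el.
have Ee t : counit (grpalg_hopf K gT) (e t) = 1 by rewrite lfunE /= grpalg_ext_el.
have Se t : antipode (grpalg_hopf K gT) (e t) = e t^-1%g.
  by rewrite lfunE /= grpalg_ext_el.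
rewrite /hopf_axioms.
move: (comul _) (counit _) (antipode _) De Ee Se => D E S De Ee Se.
split; first split.
- exact: De.
- apply: grpalg_bilinP => [b k u v|b k u v|b k u v|b k u v|s t] /=.
  + by rewrite mulrDl -scalerAl linearP.
  + by rewrite linearP tens_mulPl.
  + by rewrite mulrDr -scalerAr linearP.
  + by rewrite !linearP.
  by rewrite grpelM !De tens_mulE grpelM.
- exact: Ee.
- apply: grpalg_bilinP => [b k u v|b k u v|b k u v|b k u v|s t] /=.
  + by rewrite mulrDl -scalerAl linearP.
  + by rewrite linearP mulrDl scalerAl.
  + by rewrite mulrDr -scalerAr linearP.
  + by rewrite linearP mulrDr scalerAr.
  by rewrite grpelM !Ee mulr1.
- apply: grpalg_linP => [k u v|k u v|t]; rewrite ?linearP // De.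
  by rewrite !sweedler_tensor ?De ?sweedler_tensor // => b k u v /=;
    first [by rewrite tensorPl | by rewrite tensorPr | by rewrite linearP tensorPr
    | by rewrite !linearP | by rewrite tensorPl tensorPr
    | by apply: sweedler_fun => x y; rewrite !tensorPr].
- move=> u; split; move: u; apply: grpalg_linP => [k u v|//|t]; rewrite ?linearP // De sweedler_tensor ?Ee ?scale1r // => b k u v /=.
  + by rewrite linearP scalerDl scalerA.
  + by rewrite scalerDr !scalerA mulrC.
  + by rewrite scalerDr !scalerA mulrC.
  + by rewrite linearP scalerDl scalerA.
- move=> u; split; move: u; apply: grpalg_linP => [k u v|k u v|t]; rewrite ?linearP ?scalerDl ?scalerA // De sweedler_tensor ?Ee ?Se ?grpelM ?mulVg ?mulgV ?scale1r // => b k u v /=.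
  + by rewrite linearP mulrDl scalerAl.
  + by rewrite mulrDr scalerAr.
  + by rewrite mulrDl scalerAl.
  + by rewrite linearP mulrDr scalerAr.
Qed.

Section KPHopf.
Variable K : fieldType.
Notation kp := (kac_paljutkin K).
Notation e := (kp_el K).
Notation x := (kp_x K).

Lemma V4gg (t : V4) : (t * V4g * V4g)%g = t. Proof. by case: t => [[] []]. Qed.
Lemma V4hh (t : V4) : (t * V4h * V4h)%g = t. Proof. by case: t => [[] []]. Qed.
Lemma V4hg (t : V4) : (t * V4h * V4g)%g = (t * V4g * V4h)%g.
Proof. by case: t => [[] []]. Qed.

Lemma V4swapg (t : V4) : V4swap (t * V4g)%g = (V4swap t * V4h)%g.
Proof. by []. Qed.
Lemma V4swaph (t : V4) : V4swap (t * V4h)%g = (V4swap t * V4g)%g.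
Proof. by []. Qed.

Lemma lin4 (U W : lmodType K) (f : {linear U -> W}) k a b c d :
  f (k *: (a + b + c - d)) = k *: (f a + f b + f c - f d).
Proof. by rewrite linearZ_LR linearB !linearD. Qed.
Lemma coord4 (U : vectType K) n (X : n.-tuple U) i k a b c d :
  coord X i (k *: (a + b + c - d)) =
  k * (coord X i a + coord X i b + coord X i c - coord X i d).
Proof. by rewrite linearZ linearB !linearD. Qed.
Lemma tens4 (U V : vectType K) (a b c d : tens U V) k i j :
  (k *: (a + b + c - d)) i j = k * (a i j + b i j + c i j - d i j).
Proof. by rewrite !mxE. Qed.
Lemma tensorE (U V : vectType K) (u : U) (v : V) i j :
  (u ⊗ v) i j = coord (vbasis {:U}) i u * coord (vbasis {:V}) j v.
Proof. by rewrite mxE. Qed.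
Lemma tens_mul4l (t a b c d : tens kp kp) k :
  tens_mul (k *: (a + b + c - d)) t =
  k *: (tens_mul a t + tens_mul b t + tens_mul c t - tens_mul d t).
Proof. exact: lin4. Qed.

Lemma kp_bilinP (W : lmodType K) (f1 f2 : kp -> kp -> W) :
    (forall b, linear (f1^~ b)) -> (forall b, linear (f2^~ b)) ->
    (forall a, linear (f1 a)) -> (forall a, linear (f2 a)) ->
    (forall s t, f1 (e s) (e t) = f2 (e s) (e t)) ->
    (forall s t, f1 (e s) (e t * x) = f2 (e s) (e t * x)) ->
    (forall s t, f1 (e s * x) (e t) = f2 (e s * x) (e t)) ->
    (forall s t, f1 (e s * x) (e t * x) = f2 (e s * x) (e t * x)) ->
  f1 =2 f2.
Proof.
move=> l1 l2 r1 r2 E00 E01 E10 E11 a b; move: a.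
by apply: kp_linP => // s; move: b; apply: kp_linP.
Qed.

Lemma kp_elxM s t : (e s * x) * (e t * x) = 2^-1 *:
  (e (s * V4swap t)%g + e (s * V4swap t * V4g)%g
   + e (s * V4swap t * V4h)%g - e (s * V4swap t * V4g * V4h)%g).
Proof.
rewrite -mulrA (mulrA x) kp_x_el mulrA mulrA -(mulrA _ x x) kp_xx !kp_elM.
by rewrite -scalerAr mulrBr !mulrDr mulr1 !kp_elM !mulgA.
Qed.

Lemma coordP (U : vectType K) (u v : U) :
  (forall i, coord (vbasis {:U}) i u = coord (vbasis {:U}) i v) -> u = v.
Proof.
by move=> E; rewrite (vb_expand u) (vb_expand v); apply: eq_bigr => i _; rewrite E.
Qed.

Lemma kp_J_sum (p q r s : kp) : 2 != 0 :> K ->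
  2^-1 *: (2^-1 *: (p + q + r - s) + 2^-1 *: (q + p + s - r)
           + 2^-1 *: (r + s + p - q) - 2^-1 *: (s + r + q - p)) = p.
Proof. by move=> n2; apply: coordP => i; rewrite !coord4; field. Qed.

Lemma kp_J_tensor (p q r s : kp) : 2 != 0 :> K ->
  let J0 := 2^-1 *: (p + q + r - s) in let J1 := 2^-1 *: (q + p + s - r) in
  let J2 := 2^-1 *: (r + s + p - q) in let J3 := 2^-1 *: (s + r + q - p) in
  2^-1 *: (p ⊗ p + q ⊗ q + r ⊗ r - s ⊗ s) =
  2^-1 *: (2^-1 *: (J0 ⊗ J0 + J0 ⊗ J1 + J2 ⊗ J0 - J2 ⊗ J1)
         + 2^-1 *: (J0 ⊗ J2 + J0 ⊗ J3 + J2 ⊗ J2 - J2 ⊗ J3)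
         + 2^-1 *: (J1 ⊗ J0 + J1 ⊗ J1 + J3 ⊗ J0 - J3 ⊗ J1)
         - 2^-1 *: (J1 ⊗ J2 + J1 ⊗ J3 + J3 ⊗ J2 - J3 ⊗ J3)) :> tens kp kp.
Proof.
move=> n2 J0 J1 J2 J3.
have [E0 E1 E2 E3] : [/\ J0 = 2^-1 *: (p + q + r - s), J1 = 2^-1 *: (q + p + s - r),
  J2 = 2^-1 *: (r + s + p - q) & J3 = 2^-1 *: (s + r + q - p)] by [].
move: J0 J1 J2 J3 E0 E1 E2 E3 => J0 J1 J2 J3 E0 E1 E2 E3.
apply/matrixP => i j; rewrite !tens4 !tensorE E0 E1 E2 E3 !coord4.
by field.
Qed.

Lemma tensor4r (U V : vectType K) (u : U) k (a b c d : V) :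
  u ⊗ (k *: (a + b + c - d)) = k *: (u ⊗ a + u ⊗ b + u ⊗ c - u ⊗ d).
Proof. by apply/matrixP => i j; rewrite tens4 !tensorE coord4; ring. Qed.

Lemma kp_hopfP : 2 != 0 :> K -> hopf_axioms (kp_hopf K).
Proof.
move=> n2.
have De t : comul (kp_hopf K) (e t) = e t ⊗ e t := kp_comul_el K t.
have Dx t := kp_comul_elx K t.
have Ee t : counit (kp_hopf K) (e t) = 1 by rewrite lfunE /= kp_ext_el.
have Ex t : counit (kp_hopf K) (e t * x) = 1 by rewrite lfunE /= kp_ext_elx.
have Se t : antipode (kp_hopf K) (e t) = e t by rewrite lfunE /= kp_ext_el.
have Sx t : antipode (kp_hopf K) (e t * x) = e (V4swap t) * x.
  by rewrite lfunE /= kp_ext_elx kp_x_el.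
rewrite /hopf_axioms.
move: (comul _) (counit _) (antipode _) De Dx Ee Ex Se Sx => D E S De Dx Ee Ex Se Sx.
split; first split.
- exact: De.
- apply: kp_bilinP => [b k u v|b k u v|b k u v|b k u v|s t|s t|s t|s t] /=.
  + by rewrite mulrDl -scalerAl linearP.
  + by rewrite linearP tens_mulPl.
  + by rewrite mulrDr -scalerAr linearP.
  + by rewrite !linearP.
  + by rewrite kp_elM !De tens_mulE kp_elM.
  + rewrite mulrA kp_elM !Dx De [RHS]lin4 /= !tens_mulE.
    by rewrite !mulrA !kp_elM !mulgA.
  + rewrite -mulrA kp_x_el mulrA kp_elM !Dx De tens_mul4l !tens_mulE.
    rewrite -!mulrA !kp_x_el !mulrA !kp_elM.
    by rewrite -!mulgA ![(_ * V4swap t)%g]V4mulC.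
  rewrite kp_elxM [LHS]lin4 /= !De [D (e t * x)]Dx [RHS]lin4 /= !Dx !tens_mul4l.
  rewrite !tens_mulE !kp_elxM.
  set w := V4swap t; rewrite !(V4swapg, V4swaph) -/w !mulgA.
  have sg : (s * V4g * w = s * w * V4g)%g by rewrite -mulgA (V4mulC V4g) mulgA.
  have sh : (s * V4h * w = s * w * V4h)%g by rewrite -mulgA (V4mulC V4h) mulgA.
  rewrite !(sg, sh) !(V4gg, V4hh, V4hg); move: (s * w)%g => r.
  exact: kp_J_tensor.
- exact: (Ee 1%g).
- apply: kp_bilinP => [b k u v|b k u v|b k u v|b k u v|s t|s t|s t|s t] /=.
  + by rewrite mulrDl -scalerAl linearP.
  + by rewrite linearP mulrDl scalerAl.
  + by rewrite mulrDr -scalerAr linearP.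
  + by rewrite linearP mulrDr scalerAr.
  + by rewrite kp_elM !Ee mulr1.
  + by rewrite mulrA kp_elM Ee !Ex mulr1.
  + by rewrite -mulrA kp_x_el mulrA kp_elM Ee !Ex mulr1.
  rewrite kp_elxM lin4 /= !Ee !Ex addrK.
  by rewrite mulr1 [LHS](mulVf n2).
- have L b1 b2 : sweedler (fun a b => sweedler (fun c d => c ⊗ (d ⊗ b)) (D a)) (b1 ⊗ b2)
      = sweedler (fun c d => c ⊗ (d ⊗ b2)) (D b1).
    rewrite sweedler_tensor // => b k u v; rewrite ?linearP //.
    by apply: sweedler_fun => c d; rewrite !tensorPr.
  have R b1 b2 : sweedler (fun a b => a ⊗ D b) (b1 ⊗ b2) = b1 ⊗ D b2.
    by rewrite sweedler_tensor // => b k u v; rewrite ?tensorPl // linearP tensorPr.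
  have L2 b1 b2 b : sweedler (fun c d => c ⊗ (d ⊗ b)) (b1 ⊗ b2) = b1 ⊗ (b2 ⊗ b).
    by rewrite sweedler_tensor // => b' k u v; rewrite ?tensorPl ?tensorPr.
  apply: kp_linP => [k u v|k u v|t|t]; rewrite ?linearP //.
    by rewrite De L R De L2.
  rewrite Dx !lin4 /= !L !R !Dx.
  rewrite !lin4 /= !L2 !V4gg !V4hh !V4hg.
  rewrite !tensor4r.
  move: (e t * x) (e (t * V4g)%g * x) (e (t * V4h)%g * x) (e (t * V4g * V4h)%g * x).
  move=> p q r s; apply/matrixP => i j; rewrite !mxE; ring.
- move=> u; split; move: u.
    have F b1 b2 : sweedler (fun a b => E a *: b) (b1 ⊗ b2) = E b1 *: b2.
      rewrite sweedler_tensor // => b k u v; first by rewrite linearP scalerDl scalerA.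
      by rewrite scalerDr !scalerA mulrC.
    apply: kp_linP => [k u v|//|t|t]; rewrite ?linearP //.
      by rewrite De F Ee scale1r.
    rewrite Dx lin4 /= !F !Ex !scale1r addrAC addrK.
    by rewrite -mulr2n -scaler_nat scalerA mulVf // scale1r.
  have F b1 b2 : sweedler (fun a b => E b *: a) (b1 ⊗ b2) = E b2 *: b1.
    rewrite sweedler_tensor // => b k u v; last by rewrite linearP scalerDl scalerA.
    by rewrite scalerDr !scalerA mulrC.
  apply: kp_linP => [k u v|//|t|t]; rewrite ?linearP //.
    by rewrite De F Ee scale1r.
  rewrite Dx lin4 /= !F !Ex !scale1r addrK.
  by rewrite -mulr2n -scaler_nat scalerA mulVf // scale1r.
- have lE : linear (fun u : kp => E u *: (1 : kp)).
    by move=> k u v; rewrite linearP scalerDl scalerA.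
  move=> u; split; move: u.
    have F b1 b2 : sweedler (fun a b => S a * b) (b1 ⊗ b2) = S b1 * b2.
      rewrite sweedler_tensor // => b k u v; first by rewrite linearP mulrDl scalerAl.
      by rewrite mulrDr scalerAr.
    apply: kp_linP => [k u v|//|t|t]; rewrite ?linearP //.
      by rewrite De F Ee Se kp_elM scale1r; case: t => [[] []].
    rewrite Dx lin4 /= !F Ex !Sx !kp_elxM scale1r.
    have E0 : (V4swap t * V4swap t = 1)%g by clear; case: t => [[] []].
    have E1 : (V4swap t * V4swap (t * V4g) = 1 * V4h)%g by clear; case: t => [[] []].
    have E2 : (V4swap (t * V4h) * V4swap t = 1 * V4g)%g by clear; case: t => [[] []].
    have E3 : (V4swap (t * V4h) * V4swap (t * V4g) = 1 * V4g * V4h)%g.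
      by clear; case: t => [[] []].
    rewrite !(E0, E1, E2, E3) !(V4gg, V4hh, V4hg) [X in _ *: (X - _)]addrAC.
    exact: kp_J_sum.
  have F b1 b2 : sweedler (fun a b => a * S b) (b1 ⊗ b2) = b1 * S b2.
    rewrite sweedler_tensor // => b k u v; first by rewrite mulrDl scalerAl.
    by rewrite linearP mulrDr scalerAr.
  apply: kp_linP => [k u v|//|t|t]; rewrite ?linearP //.
    by rewrite De F Ee Se kp_elM scale1r; case: t => [[] []].
  rewrite Dx lin4 /= !F Ex !Sx !kp_elxM scale1r.
  have E0 : (t * V4swap (V4swap t) = 1)%g by clear; case: t => [[] []].
  have E1 : (t * V4swap (V4swap (t * V4g)) = 1 * V4g)%g by clear; case: t => [[] []].
  have E2 : (t * V4h * V4swap (V4swap t) = 1 * V4h)%g by clear; case: t => [[] []].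
  have E3 : (t * V4h * V4swap (V4swap (t * V4g)) = 1 * V4g * V4h)%g.
    by clear; case: t => [[] []].
  rewrite !(E0, E1, E2, E3) !(V4gg, V4hh, V4hg).
  exact: kp_J_sum.
Qed.
End KPHopf.

Section Grouplikes.
Variable K : fieldType.
Notation kp := (kac_paljutkin K).
Notation e := (kp_el K).
Notation x := (kp_x K).

Let c (l : bool) (s : V4) (u : kp) : K := if l then u.2 s else u.1 s.

Let c_linear l s : linear (c l s : kp -> K^o).
Proof. by move=> k u v; rewrite /c; case: l; rewrite !ffunE. Qed.
Let c_el l s t : c l s (e t) = (~~ l && (s == t))%:R.
Proof. by case: l; rewrite /c /= ffunE. Qed.
Let c_elx l s t : c l s (e t * x) = (l && (s == t))%:R.
Proof. by rewrite kp_el_x; case: l; rewrite /c /= ffunE. Qed.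

Let pair_D l m s r (u : kp) : K^o :=
  sweedler (fun a b => c l s a * c m r b : K^o) (comul (kp_hopf K) u).

Let pairE l m s r (a b : kp) :
  sweedler (fun a b => c l s a * c m r b : K^o) (a ⊗ b) = c l s a * c m r b.
Proof.
rewrite sweedler_tensor // => b' k u v; first by rewrite c_linear mulrDl [_ *: _ in LHS]/GRing.scale /= -mulrA.
by rewrite c_linear mulrDr [_ *: _ in LHS]/GRing.scale /= mulrCA.
Qed.

Let pairP l m s r (F : kp -> K^o) : linear F ->
  (forall t, F (e t) = (~~ l && (s == t))%:R * (~~ m && (r == t))%:R) ->
  (forall t, F (e t * x) = 2^-1 * ([&& l, m, s == t & r == t]%:R
     + [&& l, m, s == t & r == t * V4g]%g%:R
     + [&& l, m, s == t * V4h & r == t]%g%:R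
     - [&& l, m, s == t * V4h & r == t * V4g]%g%:R)) ->
  forall u, grouplike (kp_hopf K) u -> c l s u * c m r u = F u.
Proof.
move=> lF F0 F1 u [_ Du]; rewrite -pairE -Du; move: {Du} u.
apply: (kp_linP (f1 := pair_D l m s r)) => // [k u v|t|t].
    by rewrite /pair_D !linearP.
  by rewrite /pair_D kp_comul_el pairE !c_el F0.
rewrite /pair_D kp_comul_elx lin4 /= !pairE !c_elx F1; congr (_ * _).
by case: l {F0 F1}; case: m; rewrite /= ?mul0r ?mulr0 // -!natrM !mulnb.
Qed.

Lemma kp_grouplikeP (u : kp) : 2 != 0 :> K ->
  grouplike (kp_hopf K) u <-> exists t, u = e t.
Proof.
move=> n2; split; last first.
  case=> t ->; split; last exact: kp_comul_el.
  by apply/eqP => /(congr1 (c false t))/eqP; rewrite c_el eqxx /c !ffunE oner_eq0.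
move=> gu; have [u0 Du] := gu.
pose a s := c false s u; pose b s := c true s u.
have aa s r : a s * a r = (s == r)%:R * a s.
  apply: (pairP (F := fun u => (s == r)%:R * c false s u)) => // [k v w|t|t].
  - by rewrite c_linear mulrDr [_ *: _ in LHS]/GRing.scale /= mulrCA.
  - by rewrite c_el -!natrM !mulnb /=; case: (s =P t) => [->|_]; rewrite ?andbF // andbT eq_sym.
  by rewrite c_elx /= !mulr0 !addr0 subr0 mulr0.
have ab s r : a s * b r = 0.
  apply: (pairP (F := fun u => 0)) => // [k v w|t|t].
  - by rewrite scaler0 addr0.
  - by rewrite mulr0.
  by rewrite !addr0 subr0 mulr0.
have bb s r : b s * b r = 2^-1 * ((r == s)%:R * b s + (r == s * V4g)%g%:R * b s
     + (r == s * V4h)%g%:R * b (s * V4h)%g - (r == s * V4g * V4h)%g%:R * b (s * V4h)%g).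
  apply: (pairP (F := fun u : kp => 2^-1 * ((r == s)%:R * c true s u
     + (r == s * V4g)%g%:R * c true s u + (r == s * V4h)%g%:R * c true (s * V4h)%g u
     - (r == s * V4g * V4h)%g%:R * c true (s * V4h)%g u))) => // [k v w|t|t].
  - by rewrite !c_linear /GRing.scale /=; ring.
  - by rewrite !c_el /= !mulr0 !addr0 subr0 mulr0.
  rewrite !c_elx /= -!natrM !mulnb; congr (_ * _).
  by case: s => [[] []]; case: r => [[] []]; case: t => [[] []].
case: (pickP (fun s => a s != 0)) => [s as0|a0].
  exists s; have b0 r : b r = 0 by apply: (mulfI as0); rewrite ab mulr0.
  have a1 r : a r = (r == s)%:R.
    by apply: (mulfI as0); rewrite aa mulrC eq_sym.
  rewrite [u]surjective_pairing; congr (_, _); apply/ffunP => r; rewrite !ffunE.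
    exact: a1.
  exact: b0.
case: (pickP (fun s => b s != 0)) => [s bs0|b0]; last first.
  case/eqP: u0; rewrite [u]surjective_pairing; congr (_, _); apply/ffunP => r;
    rewrite !ffunE; apply/eqP.
    exact: negbFE (a0 r).
  exact: negbFE (b0 r).
have b1 r : b r * b r = 2^-1 * b r by rewrite bb; case: r => [[] []] /=; ring.
have bg r : b r * b (r * V4g)%g = 2^-1 * b r.
  by rewrite bb; case: r => [[] []] /=; ring.
have bh r : b r * b (r * V4h)%g = 2^-1 * b (r * V4h)%g.
  by rewrite bb; case: r => [[] []] /=; ring.
have bk r : b r * b (r * V4g * V4h)%g = - (2^-1 * b (r * V4h)%g).
  by rewrite bb; case: r => [[] []] /=; ring.
have half r : b r != 0 ->
    [/\ b r = 2^-1, b (r * V4g)%g = 2^-1 & b (r * V4h)%g = 2^-1].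
  move=> br; split; apply: (mulIf br); first exact: b1.
    by rewrite mulrC bg.
  by have := bh (r * V4h)%g; rewrite V4hh.
have [hs hg hh] := half s bs0.
have [|_ _ hk] := half (s * V4g)%g; first by rewrite hg invr_eq0.
have := bk s; rewrite hs hh hk => /eqP; rewrite -subr_eq0 opprK -mulrDl.
have -> : 2^-1 + 2^-1 = 1 :> K by field.
by rewrite mul1r invr_eq0 (negPf n2).
Qed.

End Grouplikes.

(* Main.v *)
(* For lambda_zeta, the algebra A_lambda is spanned by 1, gh, x + zeta g x and
   h x - zeta g h x. The antipode maps x + zeta g x to x + zeta h x, which is
   not in this span: on A_lambda, the coefficient of g x is zeta times the one
   of x. For lambda_N^0, A_lambda is spanned by N, hence it is the image of the
   injective Hopf algebra morphism k N -> A extending the inclusion. *)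
Require Import Defs.
From HB Require Import structures.
From mathcomp Require Import all_boot all_order all_algebra.
From mathcomp Require Import all_fingroup all_solvable all_field.
From mathcomp Require Import ring.

Set Implicit Arguments.
Unset Strict Implicit.
Unset Printing Implicit Defensive.

Import GRing.Theory.
Local Open Scope ring_scope.

Lemma hopf_subalgebra_limg (K : fieldType) (A B : falgType K)
    (HA : hopf_data A) (HB : hopf_data B) (f : 'Hom(A, B)) :
  hopf_morphism HA HB f -> hopf_subalgebra HB (limg f).
Proof.
case=> f1 fM fD _ fS; split.
- by rewrite -f1 memv_img ?memvf.
- apply/prodvP => _ _ /memv_imgP[u _ ->] /memv_imgP[v _ ->].
  by rewrite -fM memv_img ?memvf.
- apply/subvP => _ /memv_imgP[_ /memv_imgP[u _ ->] ->].
  (* Comultiplicativity of [f] expands the coproduct of [f u] into a combination of tensors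
     [f a ⊗ f b], with [a], [b] running over a basis of [A]. *)
  rewrite fD; apply: memv_suml => i _; apply: memv_suml => j _.
  by apply/memvZ/mem_tensv; rewrite memv_img ?memvf.
apply/subvP => _ /memv_imgP[_ /memv_imgP[u _ ->] ->].
by rewrite -fS memv_img ?memvf.
Qed.

Section SmashMap.
Variable K : fieldType.
Notation kp := (kac_paljutkin K).
Notation H := (kp_hopf K).
Notation e := (kp_el K).
Notation x := (kp_x K).
Variable l : 'Hom(kp, K^o).

(** By [memv_smash] the range of this map is A_lambda, so linear claims about A_lambda can be
    checked on the images of the basis elements t and t x. *)
Definition smash_map (u : kp) : kp := sweedler (fun a b => l a *: b) (comul H u).

Fact smash_map_linear : linear smash_map.
Proof. by move=> k u v; rewrite /smash_map !linearP. Qed.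

Lemma sweedler_smash (a b : kp) :
  sweedler (fun a b => l a *: b) (a ⊗ b) = l a *: b.
Proof.
rewrite sweedler_tensor // => c k u v; first by rewrite linearP scalerDl scalerA.
by rewrite scalerDr !scalerA mulrC.
Qed.

Lemma smash_map_el t : smash_map (e t) = l (e t) *: e t.
Proof. by rewrite /smash_map kp_comul_el sweedler_smash. Qed.

Lemma smash_map_elx t : smash_map (e t * x) = 2^-1 *:
  (l (e t * x) *: (e t * x) + l (e t * x) *: (e (t * V4g)%g * x)
   + l (e (t * V4h)%g * x) *: (e t * x)
   - l (e (t * V4h)%g * x) *: (e (t * V4g)%g * x)).
Proof. by rewrite /smash_map kp_comul_elx lin4 /= !sweedler_smash. Qed.

End SmashMap.

Section Zeta.
Variables (K : fieldType) (zeta : K).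
Hypotheses (char2 : 2 != 0 :> K) (zeta2 : zeta ^+ 2 = -1).
Notation kp := (kac_paljutkin K).
Notation H := (kp_hopf K).
Notation e := (kp_el K).
Notation x := (kp_x K).
Notation l := (lambda_zeta zeta).

Let phi (u : kp) : K^o := u.2 V4g - zeta * u.2 1%g.

Let phi_linear : linear phi.
Proof. by move=> k u v; rewrite /phi /= !ffunE /= /GRing.scale /=; ring. Qed.

Let phi_elx t : phi (e t * x) = (V4g == t)%:R - zeta * (1%g == t)%:R.
Proof. by rewrite kp_el_x /phi /= !ffunE. Qed.

Let lambda_elx t :
  l (e t * x) = if t \in [set 1; V4g * V4h]%g then (1 + zeta) / 2 else (1 - zeta) / 2.
Proof. by rewrite lfunE /= kp_ext_elx. Qed.

(** It suffices that the linear form [phi] vanishes on the images of the basis. Only the images of x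
    and g x, namely (x + zeta g x)/2 and (g x - zeta x)/2, have components along x or g x. *)
Lemma smash_lambda_zeta_coord (u : kp) :
  u \in smash H l -> u.2 V4g = zeta * u.2 1%g.
Proof.
case/memv_smash => v ->; apply/eqP; rewrite -subr_eq0; apply/eqP.
rewrite -[LHS]/(phi (smash_map l v)); move: v.
apply: (kp_linP (f2 := fun=> 0)) => [k u1 v1|k u1 v1|t|t].
- by rewrite smash_map_linear phi_linear.
- by rewrite scaler0 addr0.
- by rewrite smash_map_el /phi /= !ffunE; ring.
pose phiL : {linear kp -> K^o} :=
  HB.pack phi (GRing.isLinear.Build _ _ _ _ _ phi_linear).
rewrite smash_map_elx -[LHS]/(phiL _) lin4 !linearZ_LR -[phiL _]/(phi _).
rewrite -[phiL _]/(phi (e (t * V4g)%g * x)) !phi_elx !lambda_elx !inE.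
(* For t = g the value is (1 + zeta^2)/2, and this is where zeta^2 = -1 enters. *)
by case: t => [[] []] /=; rewrite /GRing.scale /=; field: zeta2.
Qed.

Lemma smash_lambda_zeta_not_hopf : ~ hopf_subalgebra H (smash H l).
Proof.
case=> _ _ _ HS.
(* 1%g, because V4 is also a ring and its ring unit is (true, true). *)
have /(memv_img (antipode H))/(subvP HS) : smash_map l (e 1%g * x) \in smash H l.
  by apply/memv_smash; exists (e 1%g * x).
have Sx t : antipode H (e t * x) = e (V4swap t) * x.
  by rewrite lfunE /= kp_ext_elx kp_x_el.
rewrite smash_map_elx lin4 /= !linearZ_LR /= !Sx => /smash_lambda_zeta_coord.
rewrite !lambda_elx !kp_el_x !inE /= !ffunE /= /GRing.scale /=.
have z0 : zeta != 0 by rewrite -sqrf_eq0 zeta2 oppr_eq0 oner_eq0.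
set L := LHS; set R := (RHS) => /eqP; rewrite -subr_eq0.
(* The antipode image is (x + zeta h x)/2: [L], its coefficient at g x, equals 0, while [R] is zeta
   times its coefficient 1/2 at x. *)
have -> : L - R = - (zeta / 2) by rewrite /L /R; field.
by rewrite oppr_eq0 mulf_eq0 invr_eq0 (negPf z0) (negPf char2).
Qed.
End Zeta.

Section LambdaN.
Variables (K : fieldType) (N : {group V4}).
Notation kp := (kac_paljutkin K).
Notation H := (kp_hopf K).
Notation e := (kp_el K).
Notation x := (kp_x K).
Notation kN := (grpalg K [subg N]).
Notation l := (lambda0 K N).

Definition subg_incl : 'Hom(kN, kp) := linfun (grpalg_ext (fun t => e (sgval t))).

Lemma subg_incl_el t : subg_incl (grpel K t) = e (sgval t).
Proof. by rewrite lfunE /= grpalg_ext_el. Qed.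

(** This yields injectivity: the coefficients of [a] can be read off its image. *)
Lemma subg_incl_coef (a : kN) t : (subg_incl a).1 (sgval t) = a t.
Proof.
have fstL : linear (fun u : kp => u.1 (sgval t) : K^o).
  by move=> k u v; rewrite /= !ffunE.
apply: (grpalg_linP (f1 := fun a => (subg_incl a).1 (sgval t) : K^o)
  (f2 := fun a : kN => a t : K^o)) => [k u v|k u v|s]; first by rewrite linearP fstL.
  by rewrite !ffunE.
by rewrite subg_incl_el !ffunE (inj_eq val_inj).
Qed.

Lemma lker_subg_incl : lker subg_incl == 0%VS.
Proof.
apply/lker0P => a b E; apply/ffunP => t.
by rewrite -!subg_incl_coef E.
Qed.

Lemma subg_incl_hopf : hopf_morphism (grpalg_hopf K [subg N]) H subg_incl.
Proof.
have lf u v k : subg_incl (k *: u + v) = k *: subg_incl u + subg_incl v.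
  exact: linearP.
have F (a b : kN) : sweedler (fun a b => subg_incl a ⊗ subg_incl b) (a ⊗ b)
    = subg_incl a ⊗ subg_incl b.
  by rewrite sweedler_tensor // => c k u v; rewrite lf ?tensorPl ?tensorPr.
split.
- exact: subg_incl_el.
- apply: grpalg_bilinP => [b k u v|b k u v|b k u v|b k u v|s t] /=.
  + by rewrite mulrDl -scalerAl lf.
  + by rewrite lf mulrDl scalerAl.
  + by rewrite mulrDr -scalerAr lf.
  + by rewrite lf mulrDr scalerAr.
  by rewrite grpelM !subg_incl_el kp_elM.
- apply: grpalg_linP => [k u v|k u v|t]; rewrite ?lf ?linearP //.
  by rewrite subg_incl_el kp_comul_el lfunE /= grpalg_ext_el F subg_incl_el.
- apply: grpalg_linP => [k u v|k u v|t]; rewrite ?lf ?linearP //.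
  by rewrite subg_incl_el !lfunE /= grpalg_ext_el kp_ext_el.
apply: grpalg_linP => [k u v|k u v|t]; rewrite ?linearP ?lf ?linearP //.
have -> : antipode (grpalg_hopf K [subg N]) (grpel K t) = grpel K t^-1%g.
  by rewrite lfunE /= grpalg_ext_el.
(* The antipode of A fixes t, which matches inversion in N because every element of [V4] is its own
   inverse. *)
by rewrite !subg_incl_el lfunE /= kp_ext_el V4inv.
Qed.

Lemma smash_map_lambda0_el t : smash_map l (e t) = (t \in N)%:R *: e t.
Proof. by rewrite smash_map_el lfunE /= kp_ext_el. Qed.

(** For lambda_N^0 the map [smash_map] is the projection onto the span of N: it fixes each t in N
    and kills every other basis element. *)
Lemma limg_subg_incl : limg subg_incl = smash H l.
Proof.
apply: subv_anti; apply/andP; split; apply/subvP => u.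
  (* An element of the image is fixed by [smash_map], so it serves as its own witness. *)
  case/memv_imgP => a _ ->; apply/memv_smash; exists (subg_incl a); move: a.
  apply: (grpalg_linP (f2 := fun a => smash_map l (subg_incl a))) => [k a b|k a b|t].
  - exact: linearP.
  - by rewrite linearP smash_map_linear.
  by rewrite subg_incl_el smash_map_lambda0_el subgP scale1r.
(* [r] keeps the coefficients at elements of N; the projection factors as [subg_incl] after [r]. *)
case/memv_smash => v ->; pose r (v : kp) : kN := [ffun t => v.1 (sgval t)].
have rL : linear r by move=> k a b; apply/ffunP => t; rewrite !ffunE.
rewrite -[X in X \in _]/(smash_map l v).
have -> : smash_map l v = subg_incl (r v).
  move: v; apply: kp_linP => [k a b|k a b|t|t].
  - exact: smash_map_linear.
  - by rewrite rL linearP.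
  - rewrite smash_map_lambda0_el; case: (boolP (t \in N)) => tN.
      have Et : sgval (subg N t) = t by apply: subgK.
      rewrite scale1r -{1}Et -subg_incl_el; congr (subg_incl _).
      by apply/ffunP => s; rewrite !ffunE -(inj_eq val_inj) /= Et.
    rewrite scale0r (_ : r _ = 0) ?linear0 //; apply/ffunP => s; rewrite !ffunE.
    by case: eqP => // E; rewrite -E subgP in tN.
  (* All left tensor factors in the coproduct of t x are of the form s x, where lambda_N^0
     vanishes. *)
  have lx s : l (e s * x) = 0 by rewrite lfunE /= kp_ext_elx.
  rewrite smash_map_elx !lx !scale0r subr0 !addr0 scaler0.
  rewrite (_ : r _ = 0) ?linear0 //; apply/ffunP => s.
  by rewrite kp_el_x !ffunE.
by rewrite memv_img ?memvf.
Qed.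

End LambdaN.

Theorem proposition5p6 (K : closedFieldType) (charK : [pchar K] =i pred0)
    (q : K) (q_prim : 4.-primitive_root q)
    (l : 'Hom(kac_paljutkin K, K^o))
    (l_partial : partial_action (kp_hopf K) l) :
  (forall zeta : K, zeta = q \/ zeta = - q -> l = lambda_zeta zeta ->
     ~ hopf_subalgebra (kp_hopf K) (smash (kp_hopf K) l)) /\
  (forall N : {group V4}, l = lambda0 K N ->
     hopf_subalgebra (kp_hopf K) (smash (kp_hopf K) l) /\
     hopf_iso_onto (grpalg_hopf K [subg N]) (kp_hopf K) (smash (kp_hopf K) l)).
Proof.
have char2 : 2 != 0 :> K by apply/negP => E; have := charK 2; rewrite !inE /= E.
split=> [zeta zetaE ->|N ->].
  apply: smash_lambda_zeta_not_hopf => //.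
  have -> : zeta ^+ 2 = q ^+ 2 by case: zetaE => ->; rewrite ?sqrrN.
  (* Since q^4 = 1, q^2 is 1 or -1; the value 1 is excluded because the order 4 of q does not divide
     2. *)
  have /eqP : (q ^+ 2) ^+ 2 = 1 by rewrite -exprM (prim_expr_order q_prim).
  rewrite sqrf_eq1 => /orP[|/eqP//].
  by rewrite -(prim_order_dvd q_prim).
rewrite -limg_subg_incl; split.
  exact: hopf_subalgebra_limg (subg_incl_hopf K N).
by exists (subg_incl K N); split; [exact: subg_incl_hopf|exact: lker_subg_incl|].
Qed.
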